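(* Let $\mu$ be a doubling Radon measure in $\mathbf{R}^{n+1}$ which is asymptotically optimally doubling. Then all pseudo-tangent measures of $\mu$ are uniform measures.
   Context: $B(r,Q)$ is the ball in $\mathbf{R}^{n+1}$ of radius $r$ and center $Q$; $\operatorname{spt}\mu$ is the support of $\mu$. A Radon measure $\mu$ on $\mathbf{R}^{n+1}$ is doubling if for each compact $K\subset\mathbf{R}^{n+1}$ there exist $C_K>1$, $R_K>0$ such that $\mu(B(2r,Q))\le C_K\,\mu(B(r,Q))$ for all $Q\in\operatorname{spt}\mu\cap K$, $r\in(0,R_K]$. A doubling Radon measure $\mu$ is asymptotically optimally doubling if for each compact $K$ with $K\cap\operatorname{spt}\mu\ne\emptyset$ and each $\tau\in(0,1]$, $$\lim_{r\to0}\inf_{Q\in K\cap\operatorname{spt}\mu}\frac{\mu(B(r\tau,Q))}{\mu(B(r,Q))}=\lim_{r\to0}\sup_{Q\in K\cap\operatorname{spt}\mu}\frac{\mu(B(r\tau,Q))}{\mu(B(r,Q))}=\tau^n .$$ For $Q\in\operatorname{spt}\mu$ and $r\in(0,1)$ put $\mu_{r,Q}(A)=\frac{\mu(rA+Q)}{\mu(B(r,Q))}$ for Borel $A\subset\mathbf{R}^{n+1}$. A nonzero Radon measure $\nu$ is a pseudo-tangent measure of $\mu$ at $Q\in\operatorname{spt}\mu$ if there exist $Q_i\in\operatorname{spt}\mu$ with $Q_i\to Q$ and positive numbers $r_i\downarrow0$ such that $\mu_{r_i,Q_i}\rightharpoonup\nu$ weakly in the sense of Radon measures, i.e. $\lim_{i\to\infty}\frac{1}{\mu(B(r_i,Q_i))}\int\varphi\big(\frac{X-Q_i}{r_i}\big)d\mu(X)=\int\varphi\,d\nu$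 for all $\varphi\in C_c(\mathbf{R}^{n+1})$. A nonzero Radon measure $\nu$ in $\mathbf{R}^{n+1}$ is a uniform measure if there is $C>0$ such that $\nu(B(r,Q))=Cr^n$ for every $Q\in\operatorname{spt}\nu$ and every $r\in(0,\infty)$. *)

(* Defs.v *)
From HB Require Import structures.
From mathcomp Require Import all_boot all_order all_algebra.
From mathcomp Require Import all_classical all_reals all_analysis.
Import Order.TTheory GRing.Theory Num.Theory.
Import numFieldNormedType.Exports.

Set Implicit Arguments.
Unset Strict Implicit.
Unset Printing Implicit Defensive.

Local Open Scope classical_set_scope.
Local Open Scope ring_scope.

(* [Rn1 R n] is R^(n+1) with its Borel sigma-algebra. It is convertible to
   ['rV[R]_n.+1], where the algebraic and topological structures live; the
   topology there comes from the sup norm, so is the usual one. *)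
Definition Rn1 (R : realType) (n : nat) : measurableType _ :=
  g_sigma_algebraType (@open 'rV[R]_n.+1).

(* The library norm on ['rV[R]_n.+1] is the sup norm, and its [ball]s are
   cubes; the balls [B r Q] below are the Euclidean ones. *)
Definition enorm (R : realType) (n : nat) (X : 'rV[R]_n.+1) : R :=
  Num.sqrt (\sum_(i < n.+1) X 0 i ^+ 2).

Definition B (R : realType) (n : nat) (r : R) (Q : 'rV[R]_n.+1)
  : set 'rV[R]_n.+1 := [set X | enorm (X - Q) < r].

Section Measures.
Context {R : realType} {n : nat}.
Local Notation E := 'rV[R]_n.+1.
Implicit Types mu nu : {measure set (Rn1 R n) -> \bar R}.

Definition radon mu : Prop :=
  [/\ forall K : set E, compact K -> (mu K < +oo)%E,
      forall V : set E, open V ->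
        mu V = ereal_sup [set mu K | K in [set K : set E |
                                           compact K /\ K `<=` V]]
    & forall A : set (Rn1 R n), measurable A ->
        mu A = ereal_inf [set mu V | V in [set V : set E |
                                           open V /\ A `<=` V]]].

Definition nonzero mu : Prop := mu setT != 0%E.

Definition spt mu : set E :=
  [set Q | forall U : set E, open U -> U Q -> (0 < mu U)%E].

Definition doubling mu : Prop :=
  forall K : set E, compact K ->
  exists C RK : R, [/\ 1 < C, 0 < RK &
    forall (Q : E) (r : R), (spt mu `&` K) Q -> 0 < r <= RK ->
      (mu (B (2 * r) Q) <= C%:E * mu (B r Q))%E].

(* For mu Radon, Q in the support and r > 0, both masses are finite and the
   denominator is nonzero, so that [fine] loses nothing; the ratio is then
   in [0, 1] for t in (0, 1], so that the real [inf] and [sup] below are taken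
   over nonempty bounded sets. *)
Definition mass_ratio mu (t r : R) (Q : E) : R :=
  fine (mu (B (r * t) Q)) / fine (mu (B r Q)).

Definition asymptotically_optimally_doubling mu : Prop :=
  forall K : set E, compact K -> K `&` spt mu !=set0 ->
  forall t : R, 0 < t <= 1 ->
    inf [set mass_ratio mu t r Q | Q in K `&` spt mu] @[r --> 0^'+]
      --> t ^+ n /\
    sup [set mass_ratio mu t r Q | Q in K `&` spt mu] @[r --> 0^'+]
      --> t ^+ n.

Definition Cc : set (E -> R) :=
  [set phi | continuous phi /\ compact (closure [set X | phi X != 0])].

(* The integral of phi against mu_{r,Q}, A |-> mu (r A + Q) / mu (B r Q). *)
Definition blowup_integral mu (r : R) (Q : E) (phi : E -> R) : R :=
  (fine (mu (B r Q)))^-1 * \int[mu]_X phi (r^-1 *: ((X : E) - Q)).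

Definition pseudo_tangent mu (Q : E) nu : Prop :=
  [/\ radon nu, nonzero nu, spt mu Q &
    exists (Q_ : nat -> E) (r_ : nat -> R),
      [/\ forall i, spt mu (Q_ i), Q_ @ \oo --> Q,
          forall i, 0 < r_ i, nonincreasing_seq r_ /\ r_ @ \oo --> 0 &
          forall phi : E -> R, Cc phi ->
            blowup_integral mu (r_ i) (Q_ i) phi @[i --> \oo]
              --> \int[nu]_X phi X]].

Definition uniform_measure nu : Prop :=
  [/\ radon nu, nonzero nu &
    exists2 C : R, 0 < C &
      forall (Q : E) (r : R), spt nu Q -> 0 < r -> nu (B r Q) = (C * r ^+ n)%:E].

End Measures.

(* Main.v *)
Require Import Defs.
From mathcomp Require Import all_boot all_order all_algebra.
From mathcomp Require Import finmap.
From mathcomp Require Import all_classical all_reals all_analysis.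
From mathcomp Require Import measurable_realfun.
From mathcomp Require Import ring lra.

(** Write [M r P] for the mass [mu (B r P)], and let [nu] be the weak limit of
    the blow-ups of [mu] at [Q_ i] with scale [r_ i]. The normalisation gives
    the blow-up at [Q_ i] mass 1 in the unit ball around 0, and optimal doubling
    will force [nu (B s X) = s ^+ n] for every [X] in [spt nu]: the constant of
    the uniform measure is 1.

    Optimal doubling is uniform over compact sets, so up to a factor close to 1,
    [M (r * b) P / M (r * a) P] is [(b / a) ^+ n] for all small [r]
    ([mass_same_center]). The key point is that the same comparison holds
    between two different centers [P] and [P'] of the support at distance
    [O(r)] ([mass_near_centers]): first enlarge the ball around [P] to a radius
    [r * L] with [L] so large that, relative to it, the distance from [P] to
    [P'] is negligible; then [B (r * L) P] sits in a ball around [P'] of almost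
    the same radius; finally shrink that ball around [P'].

    A point [X] of [spt nu] need not correspond to points of [spt mu], but since
    [nu] charges each ball around [X], the blow-ups do so eventually, and there
    are points of [spt mu] within [r_ i * e] of [Q_ i + r_ i *: X]
    ([spt_approx]). Comparing these with [Q_ i], the mass of a ball of radius
    [r_ i * s] around [Q_ i + r_ i *: X], divided by [M (r_ i) (Q_ i)], is
    eventually close to [s ^+ n], up to a slight change of the radius
    ([blowup_mass]). Continuous cutoffs squeezed between two concentric balls
    carry the estimate to [nu] ([limit_mass]). All errors are expressed by a
    factor [l > 1] and powers of it, and [l] tends to 1 at the end. *)

Import Order.TTheory GRing.Theory Num.Theory.
Import numFieldNormedType.Exports.

Set Implicit Arguments.
Unset Strict Implicit.
Unset Printing Implicit Defensive.

Local Open Scope classical_set_scope.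
Local Open Scope ring_scope.

(** * The Euclidean norm and its balls *)

Section EuclideanNorm.
Context {R : realType} {n : nat}.
Local Notation E := 'rV[R]_n.+1.
Implicit Types (X Y Z : E) (a b c r : R).

Lemma sum_sqr_ge0 X : 0 <= \sum_i X 0 i ^+ 2.
Proof. by apply: sumr_ge0 => i _; exact: sqr_ge0. Qed.

Lemma enorm_ge0 X : 0 <= enorm X.
Proof. exact: sqrtr_ge0. Qed.

Lemma enorm_sqr X : enorm X ^+ 2 = \sum_i X 0 i ^+ 2.
Proof. by rewrite sqr_sqrtr ?sum_sqr_ge0. Qed.

Lemma enorm0 : enorm (0 : E) = 0.
Proof. by rewrite /enorm big1 ?sqrtr0// => i _; rewrite mxE expr0n. Qed.

Lemma coord_le_enorm X i : `|X 0 i| <= enorm X.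
Proof.
rewrite -sqrtr_sqr ler_wsqrtr// (bigD1 i)//= lerDl.
by apply: sumr_ge0 => j _; exact: sqr_ge0.
Qed.

Lemma enorm_eq0 X : enorm X = 0 -> X = 0.
Proof.
move=> X0; apply/matrixP => i j; rewrite ord1 mxE; apply/eqP.
by rewrite -normr_eq0 eq_le normr_ge0 andbT -X0 coord_le_enorm.
Qed.

Lemma enormZ c X : 0 <= c -> enorm (c *: X) = c * enorm X.
Proof.
move=> c0; rewrite /enorm.
under eq_bigr do rewrite mxE exprMn.
by rewrite -mulr_sumr sqrtrM ?sqr_ge0// sqrtr_sqr ger0_norm.
Qed.

Lemma enormN X : enorm (- X) = enorm X.
Proof. by rewrite /enorm; under eq_bigr do rewrite mxE sqrrN. Qed.

Lemma enormB X Y : enorm (X - Y) = enorm (Y - X).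
Proof. by rewrite -enormN opprB. Qed.

(** Rather than through Cauchy-Schwarz, the inequality is obtained coordinate
    by coordinate: with [a], [b] the norms of [X], [Y], the weighted bound
    [(x + y)^2 <= (1 + b / a) x^2 + (1 + a / b) y^2] sums to [(a + b)^2]. *)
Lemma ler_enormD X Y : enorm (X + Y) <= enorm X + enorm Y.
Proof.
have [X0|X0] := eqVneq (enorm X) 0.
  by rewrite X0 (enorm_eq0 X0) !add0r.
have [Y0|Y0] := eqVneq (enorm Y) 0.
  by rewrite Y0 (enorm_eq0 Y0) !addr0.
set a := enorm X; set b := enorm Y.
have a0 : 0 < a by rewrite lt_neqAle eq_sym X0 enorm_ge0.
have b0 : 0 < b by rewrite lt_neqAle eq_sym Y0 enorm_ge0.
rewrite -(@ler_pXn2r _ 2)// ?nnegrE ?enorm_ge0 ?addr_ge0 ?enorm_ge0//.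
have -> : (a + b) ^+ 2 = (1 + b / a) * a ^+ 2 + (1 + a / b) * b ^+ 2.
  by field; rewrite ?gt_eqF.
rewrite !enorm_sqr 2!mulr_sumr -big_split/=.
apply: ler_sum => i _; rewrite mxE.
set x := X 0 i; set y := Y 0 i.
rewrite -subr_ge0.
have -> : (1 + b / a) * x ^+ 2 + (1 + a / b) * y ^+ 2 - (x + y) ^+ 2 =
    (b * x - a * y) ^+ 2 / (a * b).
  by field; rewrite ?gt_eqF.
by rewrite divr_ge0 ?sqr_ge0// mulr_ge0// ltW.
Qed.

Lemma ler_enorm_dist X Y Z : enorm (X - Z) <= enorm (X - Y) + enorm (Y - Z).
Proof. by rewrite -[X - Z](subrKA Y) ler_enormD. Qed.

Lemma enorm_continuous : continuous (@enorm R n).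
Proof.
have sumC : continuous (fun X : E => \sum_i X 0 i ^+ 2).
  apply: continuous_big => [|i _ X]; first exact: add_continuous.
  apply: (@continuous_comp _ _ _ (fun M : E => M 0 i) (fun x : R => x ^+ 2)).
    exact: coord_continuous.
  exact: exprn_continuous.
move=> X; apply: (@continuous_comp _ _ _ _ Num.sqrt); first exact: sumC.
exact: sqrt_continuous.
Qed.

Lemma enorm_dist_continuous Z : continuous (fun X : E => enorm (X - Z)).
Proof.
move=> X; apply: (@continuous_comp _ _ _ (fun X : E => X - Z) (@enorm R n)).
  by apply: (@continuousB _ _ _ id (cst Z)); [move=> ?|exact: cst_continuous].
exact: enorm_continuous.
Qed.

Lemma open_B r X : open (B r X).
Proof.
have /continuousP := @enorm_dist_continuous X.
by move=> /(_ _ (@open_lt _ r)).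
Qed.

Lemma subset_B r s X Y : enorm (X - Y) + r <= s -> B r X `<=` B s Y.
Proof.
rewrite /B => d Z /= Zr; apply: le_lt_trans (ler_enorm_dist Z X Y) _.
by rewrite addrC; apply: lt_le_trans d; rewrite ltrD2l.
Qed.

Lemma B_center r X : 0 < r -> B r X X.
Proof. by move=> r0; rewrite /B/= subrr enorm0. Qed.

Definition closedB r X : set E := [set Y | enorm (Y - X) <= r].

Lemma closed_closedB r X : closed (closedB r X).
Proof.
have /continuous_closedP := @enorm_dist_continuous X.
by move=> /(_ _ (@closed_le _ r)).
Qed.

Lemma compact_closedB r X : compact (closedB r X).
Proof.
apply: bounded_closed_compact; last exact: closed_closedB.
exists (r + enorm X); split; first exact: num_real.
move=> M rM Y; rewrite /closedB/= => Yr.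
have YM : enorm Y <= M.
  apply: le_trans (ltW rM); rewrite -[X in enorm X](subrK X).
  by apply: le_trans (ler_enormD _ _) _; rewrite lerD2r.
have M0 := le_trans (enorm_ge0 Y) YM.
rewrite (_ : `|Y| = mx_norm Y)// mx_normrE; apply: bigmax_le => // -[i j] _ /=.
by rewrite ord1; apply: le_trans YM; exact: coord_le_enorm.
Qed.

Lemma sub_B_closedB r X : B r X `<=` closedB r X.
Proof. by move=> Y; exact: ltW. Qed.

(** A piecewise linear function of the distance to [X], equal to 1 on [B a X]
    and to 0 outside [B b X]. *)
Definition cutoff a b X (Y : E) : R :=
  Num.max 0 (Num.min 1 ((b - enorm (Y - X)) / (b - a))).

Lemma cutoff_ge0 a b X Y : 0 <= cutoff a b X Y.
Proof. by rewrite le_max lexx. Qed.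

Lemma cutoff_le1 a b X Y : cutoff a b X Y <= 1.
Proof. by rewrite ge_max ler01 ge_min lexx. Qed.

Lemma cutoff1 a b X Y : a < b -> B a X Y -> cutoff a b X Y = 1.
Proof.
rewrite /B/= => ab Ya; rewrite /cutoff min_l ?max_r//.
by rewrite ler_pdivlMr ?subr_gt0// mul1r lerD2l lerN2 ltW.
Qed.

Lemma cutoff0 a b X Y : a < b -> ~ B b X Y -> cutoff a b X Y = 0.
Proof.
rewrite /B/= => ab /negP; rewrite -leNgt => bY; rewrite /cutoff max_l//.
rewrite ge_min; apply/orP; right.
by rewrite pmulr_lle0 ?subr_le0// invr_gt0 subr_gt0.
Qed.

Lemma cutoff_continuous a b X : continuous (cutoff a b X).
Proof.
move=> Y; pose h Z := (b - enorm (Z - X)) / (b - a).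
suff : {for Y, continuous (cst 0 \max (cst 1 \min h))} by [].
apply: (@continuous_max R); first exact: cst_continuous.
apply: (@continuous_min R); first exact: cst_continuous.
apply: (@continuous_comp _ _ _ (fun Z => enorm (Z - X))
  (fun t => (b - t) / (b - a))); first exact: enorm_dist_continuous.
apply: cvgM; last exact: cvg_cst.
by apply: cvgB; [exact: cvg_cst|exact: cvg_id].
Qed.

Lemma cutoff_Cc a b X : a < b -> Cc (cutoff a b X).
Proof.
move=> ab; split; first exact: cutoff_continuous.
apply: subclosed_compact (@closed_closure _ _) (@compact_closedB b X) _.
rewrite [X in _ `<=` X](closure_id _).1; last exact: closed_closedB.
apply: closureS => Y /= /eqP; apply: contra_notP => nY.
by apply: cutoff0 => // /sub_B_closedB.
Qed.

End EuclideanNorm.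

(** * Radon measures on balls *)

Section RadonMass.
Context {R : realType} {n : nat}.
Local Notation E := 'rV[R]_n.+1.
Implicit Types (mu : {measure set (Rn1 R n) -> \bar R}) (X P Q : E).

Lemma open_measurable_Rn1 (U : set E) : open U -> measurable (U : set (Rn1 R n)).
Proof. by move=> oU; exact: (@sub_sigma_algebra _ setT (@open E) _ oU). Qed.

Lemma compact_measurable_Rn1 (K : set E) :
  compact K -> measurable (K : set (Rn1 R n)).
Proof.
move=> cK; rewrite -[K]setCK; apply: measurableC; apply: open_measurable_Rn1.
by rewrite openC; apply: compact_closed cK; exact: norm_hausdorff.
Qed.

Lemma measurable_B r X : measurable (B r X : set (Rn1 R n)).
Proof. by apply: open_measurable_Rn1; exact: open_B. Qed.

Lemma continuous_measurable_Rn1 (f : E -> R) :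
  continuous f -> measurable_fun setT (f : Rn1 R n -> R).
Proof.
move=> /continuousP fc.
apply: (@measurability _ _ _ _ setT (f : Rn1 R n -> R) _ (RGenOpens.measurableE R)).
move=> A [V [x [y ->]] <-].
by rewrite setTI; apply: open_measurable_Rn1; apply: fc; exact: interval_open.
Qed.

Lemma Rintegral_squeeze mu (A V : set E) (f : E -> R) :
  open A -> open V -> (mu V < +oo)%E -> continuous f ->
  (forall X, 0 <= f X <= 1) ->
  (forall X, A X -> f X = 1) -> (forall X, ~ V X -> f X = 0) ->
  fine (mu A) <= (\int[mu]_X f X)%R <= fine (mu V).
Proof.
move=> oA oV Vfin fc f01 fA fV.
have mA := open_measurable_Rn1 oA; have mV := open_measurable_Rn1 oV.
have mf : measurable_fun setT (EFin \o f : Rn1 R n -> \bar R).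
  by apply/measurable_EFinP; exact: continuous_measurable_Rn1.
have AI : (mu A <= \int[mu]_X (f X)%:E)%E.
  have -> : mu A = (\int[mu]_X (\1_(A : set (Rn1 R n)) X)%:E)%E.
    by rewrite integral_indic// setIT.
  apply: ge0_le_integral => //.
  - exact/measurable_EFinP/measurable_indic.
  - move=> X _; rewrite lee_fin indicE; case: (boolP (X \in A)) => [/set_mem/fA ->//|_].
    by have /andP[] := f01 X.
have IV : (\int[mu]_X (f X)%:E <= mu V)%E.
  have -> : mu V = (\int[mu]_X (\1_(V : set (Rn1 R n)) X)%:E)%E.
    by rewrite integral_indic// setIT.
  apply: ge0_le_integral => //.
  - by move=> X _; rewrite lee_fin; have /andP[] := f01 X.
  - exact/measurable_EFinP/measurable_indic.
  - move=> X _; rewrite lee_fin indicE; case: (boolP (X \in V)) => [_|].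
      by have /andP[] := f01 X.
    by rewrite notin_setE => /fV ->.
have I0 : (0 <= \int[mu]_X (f X)%:E)%E := le_trans (measure_ge0 mu A) AI.
rewrite /Rintegral !fine_le// ge0_fin_numE//.
- exact: le_lt_trans IV Vfin.
- exact: le_lt_trans (le_trans AI IV) Vfin.
- exact: le_lt_trans IV Vfin.
Qed.

Definition mass mu r P : R := fine (mu (B r P)).

Lemma radon_B_fin mu r P : radon mu -> (mu (B r P) < +oo)%E.
Proof.
case=> Kfin _ _; apply: le_lt_trans (Kfin _ (@compact_closedB _ _ r P)).
apply: le_measure; rewrite ?inE.
- exact: measurable_B.
- by apply: compact_measurable_Rn1; exact: compact_closedB.
- exact: sub_B_closedB.
Qed.

Lemma massE mu r P : radon mu -> mu (B r P) = (mass mu r P)%:E.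
Proof. by move=> rmu; rewrite fineK// ge0_fin_numE// radon_B_fin. Qed.

Lemma mass_ge0 mu r P : 0 <= mass mu r P.
Proof. exact: fine_ge0. Qed.

Lemma mass_gt0 mu r P : radon mu -> spt mu P -> 0 < r -> 0 < mass mu r P.
Proof.
move=> rmu sP r0; rewrite -lte_fin -massE//.
by apply: sP; [exact: open_B|exact: B_center].
Qed.

Lemma le_mass mu r s P Q : radon mu -> enorm (P - Q) + r <= s ->
  mass mu r P <= mass mu s Q.
Proof.
move=> rmu h; rewrite -lee_fin -!massE//.
by apply: le_measure; rewrite ?inE; [exact: measurable_B..|exact: subset_B].
Qed.

(** Otherwise each compact subset of [U] is covered by open null sets, hence by
    finitely many of them, so it is null, and inner regularity makes [U]
    null. *)
Lemma spt_meets_open mu (U : set E) : radon mu -> open U -> (0 < mu U)%E ->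
  exists2 P, spt mu P & U P.
Proof.
move=> rmu oU; apply: contraPP => /forall2NP nU.
apply/negP; rewrite -leNgt; case: rmu => _ /(_ _ oU) -> _.
apply: ge_ereal_sup => _ [K [cK KU] <-].
pose null := [set V : set E | open V /\ mu V = 0%E].
have Kcover : K `<=` cover null id.
  move=> P /KU UP; have [/existsNP[V /not_implyP[oV /not_implyP[VP]]]|//] := nU P.
  by move=> /negP; rewrite lt0e measure_ge0 andbT negbK => /eqP V0; exists V.
have [D Dnull KD] : finite_subset_cover null id K.
  by move: cK; rewrite compact_cover; apply => // V [].
have [oD D0] : null (\big[setU/set0]_(V <- D) V).
  rewrite big_seq; apply: big_ind => [|V W [oV V0] [oW W0]|V /Dnull].
    by split; [exact: open0|exact: measure0].
    split; first exact: openU.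
    apply/eqP; rewrite -measure_le0.
    have {1}<- : (mu V + mu W = 0)%E by rewrite V0 W0 adde0.
    exact: measureU2 (open_measurable_Rn1 oV) (open_measurable_Rn1 oW).
  by rewrite inE.
rewrite -D0; apply: le_measure; rewrite ?inE.
- exact: compact_measurable_Rn1.
- exact: open_measurable_Rn1.
- by apply: subset_trans KD _; rewrite /cover bigcup_fset.
Qed.
End RadonMass.

(** * Powers of numbers close to 1 *)

Section PowersNearOne.
Context {R : realType}.
Implicit Types (x y l : R) (m : nat).

Lemma expr_cvg1 m : (k : R) ^+ m @[k --> 1^'+] --> (1 : R).
Proof.
rewrite -[X in _ --> X](expr1n _ m); apply: cvg_at_right_filter.
exact: exprn_continuous.
Qed.

Lemma exists_expr_le m l : 1 < l -> exists2 k, 1 < k & k ^+ m <= l.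
Proof.
move=> l1; near (1 : R)^'+ => k; exists k; near: k.
  exact: nbhs_right_gt.
exact: cvgr_le (expr_cvg1 m) _ l1.
Unshelve. all: by end_near. Qed.

Lemma ler_of_expr_ler m x y : (forall l, 1 < l -> x <= l ^+ m * y) -> x <= y.
Proof.
move=> h; have : k ^+ m * y @[k --> 1^'+] --> y.
  by rewrite -[X in _ --> X]mul1r; apply: cvgM (expr_cvg1 m) (cvg_cst _).
move=> /cvgr_to_ge; apply; near=> k; apply: h; near: k.
exact: nbhs_right_gt.
Unshelve. all: by end_near. Qed.

End PowersNearOne.

(** * Scaling of the mass of small balls *)

Section Scaling.
Context {R : realType} {n : nat}.
Local Notation E := 'rV[R]_n.+1.
Variables (mu : {measure set (Rn1 R n) -> \bar R}) (K : set E).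
Hypotheses (rmu : radon mu) (omu : asymptotically_optimally_doubling mu).
Hypotheses (cK : compact K) (K0 : K `&` spt mu !=set0).
Implicit Types (P Q : E) (a b t l r d : R).

(** The limits of the infimum and of the supremum of the mass ratio, turned into
    bounds valid at every point. As the mass ratio lies in [0, 1], the infimum
    and the supremum really bound it. *)
Lemma mass_ratio_bounds t l : 0 < t <= 1 -> 1 < l ->
  exists2 d, 0 < d & forall r P, 0 < r < d -> K P -> spt mu P ->
    t ^+ n * mass mu r P <= l * mass mu (r * t) P /\
    mass mu (r * t) P <= l * t ^+ n * mass mu r P.
Proof.
move=> /andP[t0 t1] l1; have l0 : 0 < l by lra.
have tn0 : 0 < t ^+ n by rewrite exprn_gt0.
have [Hinf Hsup] := omu cK K0 (introT andP (conj t0 t1)).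
have infl : t ^+ n / l < t ^+ n by rewrite ltr_pdivrMr// ltr_pMr.
have lsup : t ^+ n < l * t ^+ n by rewrite ltr_pMl.
have [d1 /= d10 H1] := cvgr_ge _ Hinf _ infl.
have [d2 /= d20 H2] := cvgr_le _ Hsup _ lsup.
exists (Num.min d1 d2); first by rewrite lt_min d10.
move=> r P /andP[r0 rd] KP sP.
have ballr d : r < d -> ball 0 d r.
  by rewrite /ball/= sub0r normrN gtr0_norm.
move: rd; rewrite lt_min => /andP[rd1 rd2].
have M0 Q : spt mu Q -> 0 < mass mu r Q by move=> sQ; exact: mass_gt0.
have ratio01 Q : spt mu Q -> 0 <= mass_ratio mu t r Q <= 1.
  move=> sQ; rewrite divr_ge0 ?mass_ge0//= ler_pdivrMr ?mul1r ?M0//.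
  by apply: le_mass => //; rewrite subrr enorm0 add0r ler_piMr// ltW.
have infP : inf [set mass_ratio mu t r Q | Q in K `&` spt mu] <= mass_ratio mu t r P.
  by apply: ge_inf; [exists 0 => _ [Q [_ /ratio01/andP[? _]] <-]|exists P].
have supP : mass_ratio mu t r P <= sup [set mass_ratio mu t r Q | Q in K `&` spt mu].
  by apply: ub_le_sup; [exists 1 => _ [Q [_ /ratio01/andP[_ ?]] <-]|exists P].
split.
  have := le_trans (H1 _ (ballr _ rd1) r0) infP.
  by rewrite ler_pdivrMr// mulrAC ler_pdivlMr ?M0// [X in _ <= X]mulrC.
have := le_trans supP (H2 _ (ballr _ rd2) r0).
by rewrite ler_pdivrMr ?M0.
Qed.

(** Cross-multiplied so as to be symmetric in the two radii: optimal doubling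
    compares a ball with a smaller one, and its two bounds yield the cases
    [b <= a] and [a < b]. *)
Lemma mass_same_center a b l : 0 < a -> 0 < b -> 1 < l ->
  exists2 d, 0 < d & forall r P, 0 < r < d -> K P -> spt mu P ->
    a ^+ n * mass mu (r * b) P <= l * b ^+ n * mass mu (r * a) P.
Proof.
move=> a0 b0 l1; have an0 : 0 < a ^+ n by rewrite exprn_gt0.
have bn0 : 0 < b ^+ n by rewrite exprn_gt0.
have [ba|ab] := leP b a.
  have [|d d0 H] := @mass_ratio_bounds (b / a) l _ l1.
    by rewrite divr_gt0//= ler_pdivrMr// mul1r.
  exists (d / a) => [|r P /andP[r0 rd] KP sP]; first by rewrite divr_gt0.
  have [|_] := H (r * a) P _ KP sP; first by rewrite mulr_gt0//= -ltr_pdivlMr.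
  have -> : r * a * (b / a) = r * b by field; rewrite gt_eqF.
  by rewrite expr_div_n mulrA -mulrAC ler_pdivlMr// [X in X <= _]mulrC.
have [|d d0 H] := @mass_ratio_bounds (a / b) l _ l1.
  by rewrite divr_gt0//= ler_pdivrMr// mul1r ltW.
exists (d / b) => [|r P /andP[r0 rd] KP sP]; first by rewrite divr_gt0.
have [|+ _] := H (r * b) P _ KP sP; first by rewrite mulr_gt0//= -ltr_pdivlMr.
have -> : r * b * (a / b) = r * a by field; rewrite gt_eqF.
by rewrite expr_div_n mulrAC ler_pdivrMr// [X in _ <= X -> _]mulrAC.
Qed.

(** The chain is
    [M (r * b) P ~ (b / L) ^+ n * M (r * L) P],
    [M (r * L) P <= M (r * (L + d)) Q] and
    [M (r * (L + d)) Q ~ ((L + d) / a) ^+ n * M (r * a) Q].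
    It loses the factor [((L + d) / L) ^+ n], which is close to 1 for large
    [L]. Exchanging [P] and [Q] gives the reverse comparison. *)
Lemma mass_near_centers d a b l : 0 < d -> 0 < a -> 0 < b -> 1 < l ->
  exists2 e, 0 < e & forall r P Q, 0 < r < e ->
    K P -> spt mu P -> K Q -> spt mu Q -> enorm (P - Q) <= r * d ->
    a ^+ n * mass mu (r * b) P <= l * b ^+ n * mass mu (r * a) Q.
Proof.
move=> d0 a0 b0 l1.
(* Each use of [mass_same_center] costs a factor [k], and the passage from [L]
   to [L + d = k * L] costs [k ^+ n]. *)
have [k k1 kl] := exists_expr_le (2 + n) l1.
have k0 : 0 < k by lra.
pose L := d / (k - 1).
have L0 : 0 < L by rewrite divr_gt0// subr_gt0.
have Ld : d + L = k * L by rewrite /L; field; rewrite gt_eqF// subr_gt0.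
have kL0 : 0 < k * L by rewrite mulr_gt0.
have [e1 e10 H1] := mass_same_center L0 b0 k1.
have [e2 e20 H2] := mass_same_center a0 kL0 k1.
exists (Num.min e1 e2) => [|r P Q]; first by rewrite lt_min e10.
rewrite lt_min => /andP[r0 /andP[re1 re2]] KP sP KQ sQ PQ.
have {}H1 : L ^+ n * mass mu (r * b) P <= k * b ^+ n * mass mu (r * L) P.
  by apply: H1; rewrite ?r0.
have {}H2 : a ^+ n * mass mu (r * (k * L)) Q <= k * (k * L) ^+ n * mass mu (r * a) Q.
  by apply: H2; rewrite ?r0.
have H3 : mass mu (r * L) P <= mass mu (r * (k * L)) Q.
  by apply: le_mass => //; rewrite -Ld mulrDr lerD2r.
have Ln0 : 0 < L ^+ n by rewrite exprn_gt0.
rewrite -(ler_pM2l Ln0) mulrCA.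
apply: le_trans (ler_wpM2l (exprn_ge0 _ (ltW a0)) H1) _.
rewrite mulrCA.
apply: le_trans (ler_wpM2l (mulr_ge0 (ltW k0) (exprn_ge0 _ (ltW b0)))
  (le_trans (ler_wpM2l (exprn_ge0 _ (ltW a0)) H3) H2)) _.
rewrite [X in X <= _](_ : _ =
  k ^+ (2 + n) * (L ^+ n * (b ^+ n * mass mu (r * a) Q))); last first.
  by rewrite exprD exprMn; ring.
rewrite [X in _ <= X](_ : _ = l * (L ^+ n * (b ^+ n * mass mu (r * a) Q))); last by ring.
by rewrite ler_wpM2r// !mulr_ge0 ?exprn_ge0 ?mass_ge0 ?ltW.
Qed.

End Scaling.

(** * Testing against cutoffs *)

Section Cutoffs.
Context {R : realType} {n : nat}.
Local Notation E := 'rV[R]_n.+1.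
Implicit Types (mu nu : {measure set (Rn1 R n) -> \bar R}) (X Q : E).

Lemma Rintegral_cutoff nu a b X : radon nu -> a < b ->
  mass nu a X <= (\int[nu]_Y cutoff a b X Y)%R <= mass nu b X.
Proof.
move=> rnu ab; apply: Rintegral_squeeze; [exact: open_B|exact: open_B| | | | |].
- exact: radon_B_fin.
- exact: cutoff_continuous.
- by move=> Y; rewrite cutoff_ge0 cutoff_le1.
- by move=> Y; exact: cutoff1.
- by move=> Y; exact: cutoff0.
Qed.

Lemma B_rescale r a X Q Y : 0 < r ->
  B (r * a) (Q + r *: X) Y <-> B a X (r^-1 *: (Y - Q)).
Proof.
move=> r0; rewrite /B/=.
have -> : Y - (Q + r *: X) = r *: (r^-1 *: (Y - Q) - X).
  by rewrite scalerBr scalerA divff ?gt_eqF// scale1r opprD addrA.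
by rewrite enormZ ?ltW// ltr_pM2l.
Qed.

Lemma blowup_cutoff mu r a b X Q : radon mu -> 0 < r -> a < b ->
  mass mu (r * a) (Q + r *: X) / mass mu r Q
    <= blowup_integral mu r Q (cutoff a b X)
    <= mass mu (r * b) (Q + r *: X) / mass mu r Q.
Proof.
move=> rmu r0 ab.
have M0 : 0 <= (mass mu r Q)^-1 by rewrite invr_ge0 mass_ge0.
suff /andP[lo hi] : mass mu (r * a) (Q + r *: X)
    <= (\int[mu]_Y cutoff a b X (r^-1 *: ((Y : E) - Q)))%R
    <= mass mu (r * b) (Q + r *: X).
  by rewrite /blowup_integral ![_ / _]mulrC !ler_wpM2l.
apply: Rintegral_squeeze; [exact: open_B|exact: open_B| | | | |].
- exact: radon_B_fin.
- move=> Y; apply: (@continuous_comp _ _ _ (fun Y : E => r^-1 *: (Y - Q))).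
    apply: (@continuous_comp _ _ _ (fun Y : E => Y - Q) (fun Z => r^-1 *: Z)).
      by apply: (@continuousB _ _ _ id (cst Q)); [move=> ?|exact: cst_continuous].
    exact: scaler_continuous.
  exact: cutoff_continuous.
- by move=> Y; rewrite cutoff_ge0 cutoff_le1.
- by move=> Y /(B_rescale _ _ _ _ r0); exact: cutoff1.
- by move=> Y /(B_rescale _ _ _ _ r0); exact: cutoff0.
Qed.

End Cutoffs.

(** * Blow-ups at points of the support of the limit *)

Section Blowup.
Context {R : realType} {n : nat}.
Local Notation E := 'rV[R]_n.+1.
Variables (mu nu : {measure set (Rn1 R n) -> \bar R}).
Variables (Q : E) (Q_ : nat -> E) (r_ : nat -> R).
Hypotheses (rmu : radon mu) (omu : asymptotically_optimally_doubling mu).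
Hypotheses (rnu : radon nu) (sQ : spt mu Q) (sQ_ : forall i, spt mu (Q_ i)).
Hypotheses (Q_cvg : Q_ @ \oo --> Q) (r_gt0 : forall i, 0 < r_ i).
Hypothesis r_cvg : r_ @ \oo --> 0.
Hypothesis weak_cvg : forall phi : E -> R, Cc phi ->
  blowup_integral mu (r_ i) (Q_ i) phi @[i --> \oo] --> \int[nu]_X phi X.
Implicit Types (X P : E).

(** The integral of a cutoff at [X] against [nu] is positive, hence so are the
    blow-up integrals eventually, and the balls that carry them have positive
    mass. *)
Lemma spt_approx X e : spt nu X -> 0 < e ->
  \forall i \near \oo, exists2 P, spt mu P &
    enorm (P - (Q_ i + r_ i *: X)) < r_ i * e.
Proof.
move=> sX e0; have e2 : e / 2 < e by rewrite ltr_pdivrMr// ltr_pMr// ltr1n.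
have /weak_cvg /cvgr_gt H := cutoff_Cc X e2.
have {}H : \forall i \near \oo,
    0 < blowup_integral mu (r_ i) (Q_ i) (cutoff (e / 2) e X).
  apply: H; have /andP[+ _] := Rintegral_cutoff X rnu e2.
  by apply: lt_le_trans; rewrite mass_gt0// divr_gt0.
near=> i; apply: (@spt_meets_open _ _ _ (B (r_ i * e) (Q_ i + r_ i *: X))) => //.
  exact: open_B.
rewrite massE// lte_fin.
have /andP[_] := blowup_cutoff X (Q_ i) rmu (r_gt0 i) e2.
have : 0 < blowup_integral mu (r_ i) (Q_ i) (cutoff (e / 2) e X).
  by near: i; exact: H.
by move=> /lt_le_trans /[apply]; rewrite pmulr_lgt0// invr_gt0 mass_gt0.
Unshelve. all: by end_near. Qed.

(** For [P] in [spt mu] within [r_ i * (b - a)] of [Z = Q_ i + r_ i *: X], the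
    inclusions [B (r_ i * a) Z `<=` B (r_ i * b) P] and
    [B (r_ i * a) P `<=` B (r_ i * b) Z] reduce the claim to balls with center
    [P], to be compared with the ball at [Q_ i]. *)
Lemma blowup_mass X a b l : spt nu X -> 0 < a -> a < b -> 1 < l ->
  \forall i \near \oo,
    a ^+ n <= l * (mass mu (r_ i * b) (Q_ i + r_ i *: X) / mass mu (r_ i) (Q_ i)) /\
    mass mu (r_ i * a) (Q_ i + r_ i *: X) / mass mu (r_ i) (Q_ i) <= l * b ^+ n.
Proof.
move=> sX a0 ab l1; have b0 := lt_trans a0 ab.
have e0 : 0 < b - a by rewrite subr_gt0.
pose d := enorm X + (b - a).
have d0 : 0 < d by rewrite ltr_wpDl ?enorm_ge0.
(* [K] contains [Q_ i] and [P] once [Q_ i] is within [1 / 2] of [Q], and [P] within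
   [1 / 2] of [Q_ i]. *)
pose K := closedB 1 Q.
have cK : compact K := @compact_closedB _ _ 1 Q.
have KQ : K Q by rewrite /K/closedB/= subrr enorm0.
have K0 : K `&` spt mu !=set0 by exists Q.
have [e1 e10 H1] := mass_near_centers rmu omu cK K0 d0 ltr01 b0 l1.
have [e2 e20 H2] := mass_near_centers rmu omu cK K0 d0 a0 ltr01 l1.
have QQ : \forall i \near \oo, enorm (Q_ i - Q) < 2^-1.
  have : enorm (Q_ i - Q) @[i --> \oo] --> enorm (Q - Q).
    apply: (cvg_comp Q_ (fun Y : E => enorm (Y - Q)) Q_cvg).
    exact: enorm_dist_continuous.
  rewrite subrr enorm0 => /cvgr_lt; apply; by rewrite invr_gt0.
have rsmall e : 0 < e -> \forall i \near \oo, r_ i < e.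
  by move=> ?; exact: cvgr_lt r_cvg _ _.
near=> i.
have [P sP PZ] : exists2 P, spt mu P & enorm (P - (Q_ i + r_ i *: X)) < r_ i * (b - a).
  by near: i; exact: spt_approx.
have r0 := r_gt0 i.
have PQ : enorm (P - Q_ i) <= r_ i * d.
  apply: le_trans (ler_enorm_dist _ (Q_ i + r_ i *: X) _) _.
  rewrite [Q_ i + _ in X in _ + X]addrC addrK enormZ; last exact: ltW.
  rewrite /d; lra.
have Qi : enorm (Q_ i - Q) < 2^-1 by near: i.
have KQi : K (Q_ i) by rewrite /K/closedB/=; lra.
have rd : r_ i * d < 2^-1.
  rewrite -ltr_pdivlMr//; near: i; apply: rsmall.
  by rewrite divr_gt0// invr_gt0.
have KP : K P.
  rewrite /K/closedB/=; apply: le_trans (ler_enorm_dist P (Q_ i) Q) _; lra.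
have re1 : r_ i < e1 by near: i; exact: rsmall.
have re2 : r_ i < e2 by near: i; exact: rsmall.
have M0 : 0 < mass mu (r_ i) (Q_ i) by exact: mass_gt0.
split.
  have := H2 (r_ i) (Q_ i) P; rewrite r0 re2 enormB expr1n !mulr1.
  move=> /(_ isT KQi (@sQ_ i) KP sP PQ) h.
  rewrite mulrA ler_pdivlMr//; apply: le_trans h _.
  rewrite ler_pM2l; last by lra.
  apply: le_mass => //; have := ltW PZ; rewrite mulrBr; lra.
have := H1 (r_ i) P (Q_ i); rewrite r0 re1 expr1n mul1r mulr1.
move=> /(_ isT KP sP KQi (@sQ_ i) PQ) h.
rewrite ler_pdivrMr//; apply: le_trans h.
apply: le_mass => //; rewrite enormB; have := ltW PZ; rewrite mulrBr; lra.
Unshelve. all: by end_near. Qed.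

(** For the upper bound, the cutoff enlarges the radius from [s] to [l * s] and
    [blowup_mass] then to [l ^+ 2 * s]; for the lower bound, the cutoff shrinks
    it from [s] to [s / l] and [blowup_mass] then to [s / l ^+ 2]. *)
Lemma limit_mass X s : spt nu X -> 0 < s -> mass nu s X = s ^+ n.
Proof.
move=> sX s0; apply/eqP; rewrite eq_le; apply/andP.
split; apply: (@ler_of_expr_ler _ (1 + 2 * n)) => l l1.
  have l0 : 0 < l by lra.
  have h1 : s < l * s by rewrite ltr_pMl.
  have h2 : l * s < l ^+ 2 * s by rewrite expr2 -mulrA ltr_pMl ?mulr_gt0.
  have /andP[+ _] := Rintegral_cutoff X rnu h1; move=> /le_trans; apply.
  apply: (cvgr_to_le (weak_cvg (cutoff_Cc X h1))).
  apply: filterS (blowup_mass sX (mulr_gt0 l0 s0) h2 l1) => i [_ hi].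
  have /andP[_] := blowup_cutoff X (Q_ i) rmu (r_gt0 i) h1.
  move=> /le_trans; apply.
  by rewrite exprD exprM expr1 -mulrA -exprMn.
have l0 : 0 < l by lra.
have h1 : s / l < s by rewrite ltr_pdivrMr// ltr_pMr.
have h2 : s / l ^+ 2 < s / l.
  by rewrite expr2 invfM mulrA ltr_pdivrMr// ltr_pMr// divr_gt0.
have sl0 : 0 < s / l ^+ 2 by rewrite divr_gt0// exprn_gt0.
have -> : s ^+ n = l ^+ (1 + 2 * n) * ((s / l ^+ 2) ^+ n / l).
  rewrite expr_div_n -exprM exprD expr1; field.
  by rewrite expf_neq0 gt_eqF.
rewrite ler_pM2l ?exprn_gt0//.
have /andP[_] := Rintegral_cutoff X rnu h1; apply: le_trans.
apply: (cvgr_to_ge (weak_cvg (cutoff_Cc X h1))).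
apply: filterS (blowup_mass sX sl0 h2 l1) => i [lo _].
have /andP[+ _] := blowup_cutoff X (Q_ i) rmu (r_gt0 i) h1.
by apply: le_trans; rewrite ler_pdivrMr// [leRHS]mulrC.
Qed.

End Blowup.

(** * Pseudo-tangent measures are uniform *)

Theorem theorem2p2 (R : realType) (n : nat)
    (mu : {measure set (Rn1 R n) -> \bar R}) :
  radon mu -> doubling mu -> asymptotically_optimally_doubling mu ->
  forall (Q : 'rV[R]_n.+1) (nu : {measure set (Rn1 R n) -> \bar R}),
    pseudo_tangent mu Q nu -> uniform_measure nu.
Proof.
move=> rmu _ omu Q nu [rnu nu0 sQ [Q_ [r_ [sQ_ Q_cvg r_gt0 [_ r_cvg] weak]]]].
split=> //; exists 1 => // X s sX s0; rewrite mul1r massE//.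
by rewrite (limit_mass rmu omu rnu sQ sQ_ Q_cvg r_gt0 r_cvg weak).
Qed.
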